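(* Let $\alpha=p/q\in\mathbb{Q}$, where $p,q$ are integers with $q>0$ and $\gcd(p,q)=1$, and let $\epsilon=R^{-\lambda}$ for a fixed real $\lambda$. Put $$\beta=\beta(R):=\frac{1}{q^2}\left\{\frac{\epsilon q^2R}{\sqrt{p^2+q^2}}\right\}\left(1-\left\{\frac{\epsilon q^2R}{\sqrt{p^2+q^2}}\right\}\right),$$ where $\{x\}:=x-\lfloor x\rfloor$ is the fractional part of $x$. Then, in the limit as $R\to\infty$, $$S_\alpha(\epsilon,R)=\begin{cases}\mathrm{Area}(\mathrm{Sect}_{\alpha,\epsilon}(R))+O(R), & 0\le\lambda\le\frac12,\\[2pt] \mathrm{Area}(\mathrm{Sect}_{\alpha,\epsilon}(R))+O\left(R^{2-2\lambda}\right), & \frac12<\lambda\le\frac23,\\[2pt] \mathrm{Area}(\mathrm{Sect}_{\alpha,\epsilon}(R))+\beta R^{\lambda}+O\left(R^{2-2\lambda}\right), & \frac23<\lambda<1,\\[2pt] \frac{R}{\sqrt{p^2+q^2}}+O(1), & 1<\lambda.\end{cases}$$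
   Context: For $\alpha\in\mathbb{R}$, $\epsilon>0$, $R>0$ define the sector $$\mathrm{Sect}_{\alpha,\epsilon}(R):=\{(x,y)\in\mathbb{R}_{>0}\times\mathbb{R}:\ x^2+y^2\le R^2,\ \alpha-\epsilon<y/x<\alpha+\epsilon\},$$ whose area is $\mathrm{Area}(\mathrm{Sect}_{\alpha,\epsilon}(R))=\frac{R^2}{2}\left(\tan^{-1}(\alpha+\epsilon)-\tan^{-1}(\alpha-\epsilon)\right)$, and let $$S_\alpha(\epsilon,R):=\#\left(\mathbb{Z}^2\cap \mathrm{Sect}_{\alpha,\epsilon}(R)\right)=\#\{(m,n)\in\mathbb{Z}_{>0}\times\mathbb{Z}: m^2+n^2\le R^2,\ |n-\alpha m|<m\epsilon\}.$$ The $O$-notation refers to the limit $R\to\infty$ with $\alpha$ and $\lambda$ fixed: the bounds hold for all sufficiently large $R$ with implied constants not depending on $R$. *)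

(* Defs.v *)
From HB Require Import structures.
From mathcomp Require Import all_boot all_order all_algebra.
From mathcomp Require Import finmap.
From mathcomp Require Import all_classical all_reals all_analysis.

Set Implicit Arguments.
Unset Strict Implicit.
Unset Printing Implicit Defensive.

Import Order.TTheory GRing.Theory Num.Theory.
Import numFieldNormedType.Exports.

Local Open Scope classical_set_scope.
Local Open Scope ring_scope.

(* Makes the filter [+oo] usable in the notation [f = g +O_F h]. *)
Canonical pinfty_nbhs_filter_on (R : numFieldType) :=
  FilterType (pinfty_nbhs R) _.

Definition sect (R : realType) (alpha eps r : R) : set (R * R) :=
  [set z | [/\ 0 < z.1, z.1 ^+ 2 + z.2 ^+ 2 <= r ^+ 2 &
               alpha - eps < z.2 / z.1 < alpha + eps]].

Definition sect_area (R : realType) (alpha eps r : R) : R :=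
  fine ((lebesgue_measure \x lebesgue_measure)%E (sect alpha eps r)).

Definition sect_lattice (R : realType) (alpha eps r : R) : set (int * int) :=
  [set z | sect alpha eps r (z.1%:~R, z.2%:~R)].

(* [fset_set A] is the finite set with the elements of A when A is finite and
   is empty otherwise; here A lies in a disc, so it is finite. *)
Definition sect_count (R : realType) (alpha eps r : R) : nat :=
  #|` fset_set (sect_lattice alpha eps r)|.

Definition frac (R : realType) (x : R) : R := x - (Num.floor x)%:~R.

Definition beta (R : realType) (p q : int) (eps r : R) : R :=
  let t := frac (eps * q%:~R ^+ 2 * r / Num.sqrt (p%:~R ^+ 2 + q%:~R ^+ 2)) in
  1 / q%:~R ^+ 2 * t * (1 - t).

(* Main.v *)
Require Import Defs.
From HB Require Import structures.
From mathcomp Require Import all_boot all_order all_algebra.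
From mathcomp Require Import finmap.
From mathcomp Require Import all_classical all_reals all_analysis.
From mathcomp Require Import zify ring lra.

Set Implicit Arguments.
Unset Strict Implicit.
Unset Printing Implicit Defensive.

Import Order.TTheory GRing.Theory Num.Theory.
Import numFieldNormedType.Exports.

Local Open Scope classical_set_scope.
Local Open Scope ring_scope.

(** Write al = p/q, e = R^(-lambda), E = 1 + al^2, and phi(t) = {t}(1 - {t}),
    which is [sawtooth] below.  Three independent arguments cover the four
    ranges of lambda.

    For 1/2 < lambda < 1 the error term R^(2-2 lambda) = (e R)^2 allows a
    relative error of order e in the size of the sector.  Within the sector the
    slope y/x differs from al by less than e, so x^2 + y^2 equals E x^2 up to a
    factor 1 + O(e), and the sector lies between two triangles with vertex at
    the origin, opening al +- e and right edge x = X(1 -+ c e), where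
    X = R/sqrt E and c = 2|al| + 1 ([sect_sub_triangle], [triangle_sub_sect]).  The triangle with
    right edge x = Y has area e Y^2, and this gives
    area = e R^2/E + O((e R)^2) ([sect_area_estimate]).  For its lattice points
    (m,n), sort them by k = q n - p m: as p and q are coprime, the points with a
    given k form an arithmetic progression of step q in m, and the condition on
    m is |k|/(q e) < m <= Y.  Their number is B(T - |k|) + O(1), where
    T = q e Y and B = 1/(q^2 e).  Summation over |k| <= T turns this tent
    function into exactly B(T^2 + phi(T)) ([tent_sum]), with error O(T)
    ([triangle_list]).  Here B T^2 = e Y^2 is the area and B phi(T) the extra
    term beta R^lambda.  As phi is 1-Lipschitz, passing from the right edges
    X(1 +- c e) to X costs only O((e R)^2) ([sect_count_estimate]).  For
    lambda <= 2/3 the term beta R^lambda is itself below R^(2-2 lambda).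

    For 0 <= lambda <= 1/2 the sector is cut into vertical columns.  The column
    over x has a length that varies in total by O(R) over 0 <= x <= R, since it
    is built by maxima and minima from two linear functions of bounded slope and
    the decreasing function sqrt(R^2 - x^2).  So the sum of the column lengths
    at the integers is within O(R) of their integral, the area, and the number
    of lattice points in a column differs from its length by O(1) ([sect_count_area]).

    For lambda > 1 the points of the sector have |q n - p m| < q e R < 1 once R
    is large, so they are the multiples of (q,p) in the disc
    ([sect_count_ray]). *)

(** * Counting with explicit lists *)

Section Lists.
Variable R : realType.
Implicit Types a b x y : R.

Definition int_itv a b : seq int :=
  let d : int := Num.floor b - Num.floor a in
  [seq Num.floor a + i.+1%:Z | i <- iota 0 (if 0 <= d then absz d else 0%N)].

Lemma mem_int_itv a b (n : int) : (n \in int_itv a b) = (a < n%:~R <= b).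
Proof.
rewrite -floor_lt_int -floor_ge_int /int_itv.
set fa := Num.floor a; set fb := Num.floor b.
apply/mapP/idP => [[i]|/andP[h1 h2]].
  by rewrite mem_iota; case: ifP => h /= h2 ->; lia.
exists (`|n - fa|.-1)%N; last by lia.
by rewrite mem_iota; case: ifP => h /=; lia.
Qed.

Lemma uniq_int_itv a b : uniq (int_itv a b).
Proof. by rewrite map_inj_uniq ?iota_uniq // => i j; lia. Qed.

Lemma size_int_itv_ge a b : b - a - 1 <= (size (int_itv a b))%:R.
Proof.
rewrite size_map size_iota.
have /andP[h1 h2] := floor_itv a; have /andP[h3 h4] := floor_itv b.
set fa := Num.floor a in h1 h2 *; set fb := Num.floor b in h3 h4 *.
case: ifP => h /=.
  rewrite -[X in _ <= X]/(`|fb - fa|%:Z%:~R) gez0_abs // rmorphB /=.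
  by rewrite rmorphD /= in h4; lra.
have : fb + 1 <= fa by lia.
by rewrite -(ler_int R) => h5 /=; lra.
Qed.

Lemma size_int_itv_le a b : (size (int_itv a b))%:R <= Num.max 0 (b - a + 1).
Proof.
rewrite size_map size_iota.
have /andP[h1 h2] := floor_itv a; have /andP[h3 h4] := floor_itv b.
set fa := Num.floor a in h1 h2 *; set fb := Num.floor b in h3 h4 *.
rewrite le_max; case: ifP => h /=; last by rewrite lexx.
apply/orP; right.
rewrite -[X in X <= _]/(`|fb - fa|%:Z%:~R) gez0_abs // rmorphB /=.
by rewrite rmorphD /= in h2; lra.
Qed.

End Lists.

Section Card.
Variable T : choiceType.
Implicit Types (A : set T) (s : seq T).

Lemma card_fset_set_le_size A s :
  (forall z, A z -> z \in s) -> (#|` fset_set A| <= size s)%N.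
Proof.
move=> As; have fA : finite_set A.
  by apply: (sub_finite_set _ (finite_seq s)) => z; exact: As.
apply: uniq_leq_size => [|z]; first exact: fset_uniq.
by rewrite in_fset_set // => /set_mem; exact: As.
Qed.

Lemma card_fset_set_ge_size A s : finite_set A -> uniq s ->
  (forall z, z \in s -> A z) -> (size s <= #|` fset_set A|)%N.
Proof.
move=> fA us sA; apply: uniq_leq_size => // z zs.
by rewrite in_fset_set //; apply/mem_set/sA.
Qed.
End Card.

(** The second coordinate ranges over a list that depends on the first, and [h]
    changes coordinates, so that a planar set can be listed line by line along
    an arbitrary lattice direction. *)
Definition dep_pairs (h : int -> int -> int * int) (ks : seq int)
  (js : int -> seq int) := [seq h k j | k <- ks, j <- js k].

Lemma size_dep_pairs h ks js :
  size (dep_pairs h ks js) = (\sum_(k <- ks) size (js k))%N.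
Proof. by rewrite size_allpairs_dep sumnE big_map. Qed.

Lemma uniq_dep_pairs h ks js : injective (fun kj => h kj.1 kj.2) ->
  uniq ks -> (forall k, uniq (js k)) -> uniq (dep_pairs h ks js).
Proof.
move=> hI uks ujs; apply: allpairs_uniq_dep => //.
move=> [k1 j1] [k2 j2] _ _ /= e; have := hI (k1, j1) (k2, j2) e.
by case=> -> ->.
Qed.

Lemma mem_dep_pairs h ks js k j : k \in ks -> j \in js k ->
  h k j \in dep_pairs h ks js.
Proof. by move=> kk jj; apply/allpairsPdep; exists k, j. Qed.

(** Listing the non-negative integers before the negative ones lets both halves
    be indexed by a range of natural numbers. *)
Definition int_ball (N : nat) : seq int :=
  [seq Posz i | i <- iota 0 N.+1] ++ [seq Negz i | i <- iota 0 N].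

Lemma mem_int_ball N (k : int) : (k \in int_ball N) = (`|k| <= N)%N.
Proof.
rewrite mem_cat; apply/orP/idP => [[] /mapP[i]|kN].
- by rewrite mem_iota => ? ->; lia.
- by rewrite mem_iota => ? ->; lia.
case: k kN => k kN; [left|right]; apply/mapP; exists k => //.
- by rewrite mem_iota; lia.
- by rewrite mem_iota; lia.
Qed.

Lemma uniq_int_ball N : uniq (int_ball N).
Proof.
rewrite cat_uniq !map_inj_uniq ?iota_uniq //=; try by move=> ? ? [].
rewrite andbT; apply/hasPn => k /mapP[i _ ->].
by apply/mapP => -[].
Qed.

Lemma size_int_ball N : size (int_ball N) = (2 * N + 1)%N.
Proof. by rewrite size_cat !size_map !size_iota; lia. Qed.

Lemma sum_int_ball (R : realType) N :
  \sum_(k <- int_ball N) `|k|%N%:R = N%:R * (N%:R + 1) :> R.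
Proof.
rewrite big_cat !big_map.
have sumS n (f : nat -> R) :
    \sum_(i <- iota 0 n.+1) f i = \sum_(i <- iota 0 n) f i + f n.
  by rewrite -[n.+1]addn1 iotaD big_cat big_seq1.
elim: N => [|N IH]; first by rewrite /= big_seq1 big_nil /= addr0 mul0r.
rewrite sumS /= in IH; rewrite (sumS N) (sumS N.+1) (sumS N) /= addrACA {}IH.
rewrite -!natr1; ring.
Qed.

(** * Lattice points in a triangle of rational direction *)

Lemma frac_itv (R : realType) (x : R) : 0 <= Defs.frac x < 1.
Proof.
have /andP[h1] := floor_itv x; rewrite rmorphD /= => h2.
by rewrite /Defs.frac; lra.
Qed.

(** The periodic correction in the Euler-Maclaurin formula for a tent function:
    [beta] is this function divided by q^2. *)
Definition sawtooth (R : realType) (x : R) : R := Defs.frac x * (1 - Defs.frac x).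

Lemma sawtooth_ge0 (R : realType) (x : R) : 0 <= sawtooth x.
Proof. by have /andP[h1 h2] := frac_itv x; rewrite mulr_ge0 // subr_ge0 ltW. Qed.

Lemma sawtooth_le1 (R : realType) (x : R) : sawtooth x <= 1.
Proof. by have /andP[h1 h2] := frac_itv x; rewrite /sawtooth; nra. Qed.

(** If x and y have the same integer part this is |1 - t - t'| <= 1 for t, t' in
    [0,1).  Otherwise the two values are at most the distances of x and y to the
    integer part of the larger one, and these add up to |x - y|. *)
Lemma sawtooth_lip (R : realType) (x y : R) :
  `|sawtooth x - sawtooth y| <= `|x - y|.
Proof.
wlog lexy : x y / x <= y => [hw|].
  have [/hw//|/ltW/hw] := leP x y.
  by rewrite distrC (distrC y).
have /andP[x0 x1] := frac_itv x; have /andP[y0 y1] := frac_itv y.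
rewrite (distrC x) (ger0_norm (x := y - x)) ?subr_ge0 //.
have := le_floor lexy; rewrite le_eqVlt => /predU1P[e|].
  rewrite ler_norml /sawtooth; move: x0 x1 y0 y1 lexy; rewrite /Defs.frac e.
  move: (_%:~R) => n; nra.
rewrite -lezD1 -(ler_int R) rmorphD /= => h.
have hx : sawtooth x <= 1 - Defs.frac x by rewrite /sawtooth; nra.
have hy : sawtooth y <= Defs.frac y by rewrite /sawtooth; nra.
have := sawtooth_ge0 x; have := sawtooth_ge0 y; rewrite ler_norml.
move: hx hy; rewrite /Defs.frac; lra.
Qed.

(** With N the integer part of T, the sum is (2N + 1) T - N (N + 1), and the
    substitution T = N + t leaves the constant t - t^2 besides T^2. *)
Lemma tent_sum (R : realType) (T : R) : 0 <= T ->
  \sum_(k <- int_ball (Num.truncn T)) (T - `|k|%N%:R) = T ^+ 2 + sawtooth T.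
Proof.
move=> T0; rewrite big_split sumrN sum_int_ball /= big_const_seq count_predT.
rewrite iter_addr addr0 size_int_ball -[T *+ _]mulr_natr /sawtooth /Defs.frac.
have -> : (Num.floor T)%:~R = (Num.truncn T)%:R :> R.
  by rewrite truncn_floor T0 -[RHS]/(`|Num.floor T|%:Z%:~R) gez0_abs ?floor_ge0.
rewrite natrD natrM; ring.
Qed.

Definition triangle (R : realType) (alpha eps y : R) : set (R * R) :=
  [set z | 0 < z.1 <= y /\ alpha - eps < z.2 / z.1 < alpha + eps].

Lemma slope_itvE (R : realType) (al e x y : R) : 0 < x ->
  (al - e < y / x < al + e) = ((al - e) * x < y < (al + e) * x).
Proof. by move=> x0; rewrite ltr_pdivlMr // ltr_pdivrMr. Qed.

(** Clearing denominators: q n - p m measures, in integers, how far (m,n) lies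
    from the line of slope p/q. *)
Lemma slope_itv_rat (R : realType) (p q m n : int) (e : R) : 0 < q -> 0 < m ->
  (p%:~R / q%:~R - e < n%:~R / m%:~R < p%:~R / q%:~R + e) =
  ((absz (q * n - p * m)%R)%:R < q%:~R * e * m%:~R).
Proof.
move=> q0 m0; have q0R : 0 < q%:~R :> R by rewrite ltr0z.
have m0R : 0 < m%:~R :> R by rewrite ltr0z.
rewrite slope_itvE // natr_absz intr_norm.
rewrite rmorphB !rmorphM /= ltr_norml -(ltr_pM2l q0R) -[X in _ && X](ltr_pM2l q0R).
set P := p%:~R : R; set Q := q%:~R : R in q0R *; set N := n%:~R : R.
set M := m%:~R : R.
have -> : Q * ((P / Q - e) * M) = P * M - Q * e * M by field; rewrite ?gt_eqF.
have -> : Q * ((P / Q + e) * M) = P * M + Q * e * M by field; rewrite ?gt_eqF.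
by congr andb; apply/idP/idP; lra.
Qed.

(** With u q - v p = 1, the unimodular map (k,j) |-> (k v + j q, k u + j p) has
    inverse (m,n) |-> (q n - p m, u m - v n).  For fixed k the triangle becomes
    an interval for j of length (T - |k|)/(q^2 e), half-open because the first
    condition on m is strict and the second is not. *)
Lemma triangle_list (R : realType) (p q : int) (e Y : R) :
  0 < q -> coprimez p q -> 0 < e -> 0 <= Y ->
  let T := q%:~R * e * Y in
  exists s : seq (int * int), [/\ uniq s,
    forall z, (z \in s) <-> triangle (p%:~R / q%:~R) e Y (z.1%:~R, z.2%:~R) &
    `|(size s)%:R - (T ^+ 2 + sawtooth T) / (q%:~R ^+ 2 * e)| <= 2 * T + 1].
Proof.
move=> q0 /coprimezP[[w u] uv] e0 Y0 T; rewrite /= in uv.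
have {w uv}[v uv] : exists v, u * q - v * p = 1 by exists (- w); lia.
have q0R : 0 < q%:~R :> R by rewrite ltr0z.
have qe0 : 0 < q%:~R * e by rewrite mulr_gt0.
have T0 : 0 <= T by rewrite mulr_ge0 // ltW.
pose h (k j : int) := (k * v + j * q, k * u + j * p).
have hK1 k j : q * (h k j).2 - p * (h k j).1 = k.
  by rewrite -[RHS]mulr1 -uv /=; ring.
have hK2 k j : u * (h k j).1 - v * (h k j).2 = j.
  by rewrite -[RHS]mulr1 -uv /=; ring.
have hK m n : h (q * n - p * m) (u * m - v * n) = (m, n).
  by congr pair; rewrite -[RHS]mulr1 -uv; ring.
pose js (k : int) := int_itv ((`|k|%N%:R / (q%:~R * e) - (k * v)%:~R) / q%:~R)
                     ((Y - (k * v)%:~R) / q%:~R).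
have jsE k j : (j \in js k) =
    (`|k|%N%:R < q%:~R * e * (h k j).1%:~R) && ((h k j).1%:~R <= Y).
  rewrite mem_int_itv ltr_pdivrMr // ler_pdivlMr // ltrBlDl lerBrDl /h /=.
  by rewrite ltr_pdivrMr // [in LHS](mulrC _ (q%:~R * e)) rmorphD (rmorphM _ j) /=.
exists (dep_pairs h (int_ball (Num.truncn T)) js); split.
- apply: uniq_dep_pairs; [|exact: uniq_int_ball|move=> k; exact: uniq_int_itv].
  move=> [k j] [k' j'] hh; congr pair; first by rewrite -(hK1 k j) hh hK1.
  by rewrite -(hK2 k j) hh hK2.
- move=> [m n]; split => /=.
    move=> /allpairsPdep[k [j [_]]]; rewrite jsE => /andP[h1 h2] hkj.
    have := hK1 k j; rewrite -hkj /= in h1 h2 * => kE.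
    have mR : 0 < m%:~R :> R.
      by rewrite -(pmulr_rgt0 _ qe0); apply: le_lt_trans h1; rewrite ler0n.
    split; first by rewrite /= mR.
    have m0 : 0 < m by rewrite -(ltr0z R).
    by rewrite /= slope_itv_rat // kE.
  move=> [/= /andP[mR mY]]; have m0 : 0 < m by rewrite -(ltr0z R).
  rewrite slope_itv_rat // => kT.
  rewrite -hK.
  apply: mem_dep_pairs.
    rewrite mem_int_ball truncn_ge_nat //; apply: ltW; apply: lt_le_trans kT _.
    by rewrite ler_pM2l.
  by rewrite jsE hK kT.
- rewrite size_dep_pairs natr_sum -tent_sum // mulr_suml -sumrB.
  apply: le_trans (ler_norm_sum _ _ _) _.
  apply: (@le_trans _ _ (\sum_(k <- int_ball (Num.truncn T)) 1)).
    rewrite big_seq [leRHS]big_seq; apply: ler_sum => k.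
    rewrite mem_int_ball truncn_ge_nat // => kT.
    set K : R := _%:R in kT *.
    have KY : K / (q%:~R * e) <= Y by rewrite ler_pdivrMr // mulrC.
    have := @size_int_itv_ge R ((K / (q%:~R * e) - (k * v)%:~R) / q%:~R)
                     ((Y - (k * v)%:~R) / q%:~R).
    have := @size_int_itv_le R ((K / (q%:~R * e) - (k * v)%:~R) / q%:~R)
                     ((Y - (k * v)%:~R) / q%:~R).
    rewrite -/(js k) -mulrBl opprB addrA subrK.
    have -> : (T - K) / (q%:~R ^+ 2 * e) = (Y - K / (q%:~R * e)) / q%:~R.
      by rewrite /T; field; rewrite ?gt_eqF.
    have : 0 <= (Y - K / (q%:~R * e)) / q%:~R.
      by rewrite mulr_ge0 ?subr_ge0 // invr_ge0 ltW.
    move: (_ / q%:~R) => d d0.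
    rewrite (max_idPr _) ?ler_norml; lra.
  rewrite big_const_seq count_predT iter_addr addr0 size_int_ball.
  rewrite -mulr_natr mul1r natrD natrM lerD2r ler_pM2l //.
  by rewrite -truncn_ge_nat.
Qed.

(** * The sector between two triangles *)

(** If w = y/x, then x^2 (1 + w^2) <= r^2 and |w^2 - al^2| <= (2|al| + 1) e, so
    x^2 (1 + al^2) exceeds r^2 by a factor of at most 1 + (2|al| + 1) e. *)
Lemma sect_sub_triangle (R : realType) (al e r : R) (z : R * R) :
  0 <= r -> 0 < e <= 1 -> sect al e r z ->
  triangle al e (r / Num.sqrt (1 + al ^+ 2) * (1 + (2 * `|al| + 1) * e)) z.
Proof.
case: z => x y r0 /andP[e0 e1] [/= x0 xyr slope]; split => //=; rewrite x0 /=.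
set E := 1 + al ^+ 2; set c := 2 * `|al| + 1.
have E1 : 1 <= E by rewrite lerDl sqr_ge0.
have E0 : 0 < E by exact: lt_le_trans E1.
have c0 : 0 < c by rewrite ltr_wpDl // mulr_ge0.
have [w yE] : exists w, y = w * x by exists (y / x); rewrite divfK // gt_eqF.
move: slope; rewrite yE mulfK ?gt_eqF // => /andP[w1 w2].
have wal : al ^+ 2 - w ^+ 2 <= c * e.
  have := ler_norm al; have := ler_norm (- al); rewrite normrN /c; nra.
have xE : x ^+ 2 * E <= r ^+ 2 * (1 + c * e).
  have xr : x ^+ 2 <= r ^+ 2 by apply: le_trans xyr; rewrite lerDl sqr_ge0.
  have xr0 : x ^+ 2 * (al ^+ 2 - w ^+ 2) <= r ^+ 2 * (c * e).
    apply: (@le_trans _ _ (x ^+ 2 * (c * e))); first by rewrite ler_wpM2l ?sqr_ge0.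
    by rewrite ler_wpM2r // mulr_ge0 // ltW.
  move: xyr xr0; rewrite yE /E; nra.
have ce0 : 0 <= c * e by rewrite mulr_ge0 // ltW.
rewrite -(ler_pXn2r (n := 2)) ?nnegrE ?(ltW x0) //; last first.
  by rewrite !mulr_ge0 // ?invr_ge0 ?sqrtr_ge0 // addr_ge0.
rewrite exprMn expr_div_n sqr_sqrtr ?(ltW E0) // mulrAC ler_pdivlMr //.
apply: (le_trans xE); rewrite ler_wpM2l ?sqr_ge0 //; nra.
Qed.

(** With d = (2|al| + 1) e this rests on (1 - d)^2 (1 + d) <= 1; for d >= 1 the
    triangle is empty. *)
Lemma triangle_sub_sect (R : realType) (al e r : R) (z : R * R) :
  0 <= r -> 0 < e <= 1 ->
  triangle al e (r / Num.sqrt (1 + al ^+ 2) * (1 - (2 * `|al| + 1) * e)) z ->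
  sect al e r z.
Proof.
case: z => x y r0 /andP[e0 e1] [/= /andP[x0 +] slope].
set E := 1 + al ^+ 2; set c := 2 * `|al| + 1 => xX; split => //=.
have E1 : 1 <= E by rewrite lerDl sqr_ge0.
have E0 : 0 < E by exact: lt_le_trans E1.
have c0 : 0 < c by rewrite ltr_wpDl // mulr_ge0.
have [w yE] : exists w, y = w * x by exists (y / x); rewrite divfK // gt_eqF.
move: slope; rewrite yE mulfK ?gt_eqF // => /andP[w1 w2].
have wal : w ^+ 2 - al ^+ 2 <= c * e.
  have := ler_norm al; have := ler_norm (- al); rewrite normrN /c; nra.
have ce0 : 0 <= c * e by rewrite mulr_ge0 // ltW.
have xX2 : x ^+ 2 * E <= r ^+ 2 * (1 - c * e) ^+ 2.
  rewrite -ler_pdivlMr // mulrAC -[E in _ / E]sqr_sqrtr ?(ltW E0) //.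
  by rewrite -expr_div_n -exprMn lerXn2r ?nnegrE ?(ltW x0) // (le_trans _ xX) // ltW.
have ce1 : 0 <= 1 - c * e.
  rewrite leNgt; apply/negP => h; move: xX; apply/negP; rewrite -ltNge.
  apply: le_lt_trans x0; rewrite mulr_ge0_le0 ?(ltW h) //.
  by rewrite divr_ge0 // sqrtr_ge0.
have h1 : x ^+ 2 * (1 + w ^+ 2) <= x ^+ 2 * (E * (1 + c * e)).
  rewrite ler_wpM2l ?sqr_ge0 // /E; nra.
have h2 : x ^+ 2 * (E * (1 + c * e)) <= r ^+ 2 * ((1 - c * e) ^+ 2 * (1 + c * e)).
  by rewrite !mulrA; apply: ler_wpM2r => //; lra.
have h3 : r ^+ 2 * ((1 - c * e) ^+ 2 * (1 + c * e)) <= r ^+ 2.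
  by rewrite ler_piMr ?sqr_ge0 //; nra.
nra.
Qed.

Lemma finite_sect_lattice (R : realType) (al e r : R) :
  0 <= r -> finite_set (sect_lattice al e r).
Proof.
move=> r0.
apply: (sub_finite_set (B := [set` dep_pairs pair (int_itv (-r - 1) r)
                                   (fun=> int_itv (- r - 1) r)])); last exact: finite_seq.
move=> [m n] [/= m0 mn _]; apply: mem_dep_pairs; rewrite mem_int_itv.
  by apply/andP; split; nra.
by apply/andP; split; nra.
Qed.

Lemma sqrt_slope (R : realType) (p q : int) : 0 < q ->
  Num.sqrt (p%:~R ^+ 2 + q%:~R ^+ 2) =
  q%:~R * Num.sqrt (1 + (p%:~R / q%:~R) ^+ 2) :> R.
Proof.
move=> q0; have q0R : 0 < q%:~R :> R by rewrite ltr0z.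
rewrite -[X in X * _](ger0_norm (ltW q0R)) -sqrtr_sqr -sqrtrM ?sqr_ge0 //.
by congr Num.sqrt; field; rewrite gt_eqF.
Qed.

(** The condition e r >= 1 makes every error term, of order 1, e r or
    (e r)^2, a multiple of (e r)^2. *)
Lemma sect_count_estimate (R : realType) (p q : int) (e r : R) :
  let al := p%:~R / q%:~R in
  let c := 2 * `|al| + 1 in
  let T := e * q%:~R ^+ 2 * r / Num.sqrt (p%:~R ^+ 2 + q%:~R ^+ 2) in
  0 < q -> coprimez p q -> 0 < e -> c * e <= 1 -> 1 <= e * r ->
  `|(sect_count al e r)%:R
     - (e * r ^+ 2 / (1 + al ^+ 2) + sawtooth T / (q%:~R ^+ 2 * e))|
  <= (4 * c + 4 * q%:~R + 1) * (e * r) ^+ 2.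
Proof.
move=> al c T q0 pq e0 ce1 er1.
have q1R : 1 <= q%:~R :> R by rewrite ler1z -gtz0_ge1.
have c1 : 1 <= c by rewrite lerDr mulr_ge0.
have e1 : e <= 1 by nra.
have r0 : 0 < r by rewrite -(pmulr_rgt0 _ e0); apply: lt_le_trans er1.
set E := 1 + al ^+ 2.
have E1 : 1 <= E by rewrite lerDl sqr_ge0.
have sE1 : 1 <= Num.sqrt E by rewrite -[leLHS]sqrtr1 ler_sqrt ?(le_trans _ E1).
pose X := r / Num.sqrt E.
have X0 : 0 <= X by rewrite divr_ge0 // ?ltW // (lt_le_trans _ sE1).
have Xr : X <= r by rewrite ler_pdivrMr ?(lt_le_trans _ sE1) // ler_peMr // ltW.
have TE : T = q%:~R * e * X.
  rewrite /T sqrt_slope // -/al -/E /X; field.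
  by rewrite !gt_eqF ?ltr0z ?(lt_le_trans _ sE1).
have XE : e * r ^+ 2 / E = T ^+ 2 / (q%:~R ^+ 2 * e).
  rewrite TE /X exprMn expr_div_n sqr_sqrtr ?(le_trans _ E1) //; field.
  by rewrite !gt_eqF ?ltr0z ?(lt_le_trans _ E1).
rewrite {}XE -mulrDl.
pose F (t : R) := (t ^+ 2 + sawtooth t) / (q%:~R ^+ 2 * e).
rewrite -/(F T).
have T0 : 0 <= T by rewrite TE !mulr_ge0 // ?ltW // ltr0z.
have ce0 : 0 <= c * e by nra.
(* T is proportional to the right edge of the triangle, so this compares the
   two extreme triangles with the one that ends at X. *)
have FE d : `|d| <= c * e -> `|F (T * (1 + d)) - F T| <= 4 * c * (e * r) ^+ 2.
  move=> dce; rewrite /F -mulrBl normrM [X in _ * X]ger0_norm ?invr_ge0; last first.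
    by rewrite mulr_ge0 ?sqr_ge0 // ltW.
  rewrite ler_pdivrMr ?mulr_gt0 ?exprn_gt0 ?ltr0z //.
  have := sawtooth_lip (T * (1 + d)) T.
  have -> : T * (1 + d) - T = T * d by ring.
  move=> sl; rewrite opprD addrACA; apply: (le_trans (ler_normD _ _)).
  have -> : (T * (1 + d)) ^+ 2 - T ^+ 2 = T ^+ 2 * (d * (2 + d)) by ring.
  have d1 : `|d| <= 1 by exact: le_trans ce1.
  have h1 : `|T ^+ 2 * (d * (2 + d))| <= T ^+ 2 * (c * e * 3).
    rewrite normrM (ger0_norm (sqr_ge0 T)) ler_wpM2l ?sqr_ge0 //.
    rewrite normrM ler_pM //; apply: (le_trans (ler_normD _ _)).
    by rewrite (ger0_norm (ler0n _ _)); lra.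
  have h2 : `|sawtooth (T * (1 + d)) - sawtooth T| <= T * (c * e).
    apply: (le_trans sl); rewrite normrM (ger0_norm T0) ler_wpM2l //.
  have Tr : T <= q%:~R * (e * r).
    by rewrite TE -mulrA ler_wpM2l ?ler_wpM2l // ?ltW // ltr0z.
  have h3 : T ^+ 2 * (c * e * 3) <= (q%:~R * (e * r)) ^+ 2 * (c * e * 3).
    have ce3 : 0 <= c * e * 3 by rewrite mulr_ge0.
    rewrite ler_wpM2r //.
    by rewrite ler_pXn2r ?nnegrE // (le_trans T0).
  have h4 : T * (c * e) <= (q%:~R * (e * r)) ^+ 2 * (c * e).
    rewrite ler_wpM2r //; apply: (le_trans Tr).
    by rewrite expr2 ler_peMl ?(le_trans T0) //; nra.
  have -> : 4 * c * (e * r) ^+ 2 * (q%:~R ^+ 2 * e) =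
     (q%:~R * (e * r)) ^+ 2 * (c * e * 3) + (q%:~R * (e * r)) ^+ 2 * (c * e) by ring.
  lra.
have tl d : `|d| <= c * e -> exists s : seq (int * int), [/\ uniq s,
    forall z, (z \in s) <-> triangle al e (X * (1 + d)) (z.1%:~R, z.2%:~R) &
    `|(size s)%:R - F T| <= (4 * c + 4 * q%:~R + 1) * (e * r) ^+ 2].
  move=> dce; have d1 : `|d| <= 1 by exact: le_trans ce1.
  have Y0 : 0 <= X * (1 + d).
    by rewrite mulr_ge0 //; move: d1; rewrite ler_norml; lra.
  have [s [us sP sz]] := triangle_list q0 pq e0 Y0.
  exists s; split => //.
  move: sz; rewrite [q%:~R * e * _]mulrA -TE -/(F _).
  have := FE d dce; set G := F (T * _); move: (F T) (size s)%:R => a b h1 h2.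
  have : `|b - a| <= `|b - G| + `|G - a| by exact: ler_distD.
  have h4 : T * (1 + d) <= 2 * q%:~R * (e * r).
    apply: (@le_trans _ _ (T * 2)).
      by rewrite ler_wpM2l //; move: d1; rewrite ler_norml; lra.
    rewrite TE -mulrA mulrC -!mulrA ler_wpM2l //.
    by rewrite ler_wpM2l ?ler_wpM2l // ?ltW // ltr0z.
  have : e * r <= (e * r) ^+ 2 by rewrite expr2 ler_peMl // (le_trans _ er1).
  nra.
have e01 : 0 < e <= 1 by rewrite e0.
have dp : `|c * e| <= c * e by rewrite ger0_norm.
have dm : `|- (c * e)| <= c * e by rewrite normrN ger0_norm.
rewrite ler_norml; apply/andP; split.
  have [s [us sP sz]] := tl _ dm.
  move: sz; rewrite ler_norml => /andP[+ _] => /le_trans; apply.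
  rewrite lerD2r ler_nat; apply: card_fset_set_ge_size => //.
    by apply: finite_sect_lattice; rewrite ltW.
  by move=> z /sP; apply: triangle_sub_sect => //; rewrite ltW.
have [s [us sP sz]] := tl _ dp.
move: sz; rewrite ler_norml => /andP[_]; apply: le_trans.
rewrite lerD2r ler_nat; apply: card_fset_set_le_size => // z zs.
by apply/sP; apply: sect_sub_triangle => //; rewrite ltW.
Qed.

(** * The area as an integral of column lengths *)

Section Sections.
Variable R : realType.
Implicit Types (al e r x : R).
Notation mu := (@lebesgue_measure R).

(** The square root of a negative number is 0, so the chord vanishes outside the
    disc and the column length below does too, with no case distinction. *)
Definition chord r x : R := Num.sqrt (r ^+ 2 - x ^+ 2).
Definition sect_lo al e r x : R := Num.max ((al - e) * x) (- chord r x).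
Definition sect_hi al e r x : R := Num.min ((al + e) * x) (chord r x).
Definition sect_len al e r x : R := Num.max 0 (sect_hi al e r x - sect_lo al e r x).

Lemma sect_sectionE al e r x y : 0 < x -> sect al e r (x, y) <->
  [/\ x ^+ 2 <= r ^+ 2, `|y| <= chord r x & (al - e) * x < y < (al + e) * x].
Proof.
move=> x0; rewrite /sect /= /chord slope_itvE //; split=> [[_ xyr yx]|[xr yc yx]].
  split => //; first by nra.
  by rewrite -sqrtr_sqr ler_wsqrtr //; lra.
split => //; rewrite -lerBrDl -[leRHS]sqr_sqrtr ?subr_ge0 //.
by rewrite -[y ^+ 2]real_normK ?num_real // ler_pXn2r ?nnegrE ?sqrtr_ge0.
Qed.

Lemma sect_len_out al e r x : 0 <= r -> r < x -> sect_len al e r x = 0.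
Proof.
move=> r0 rx; have xr2 : r ^+ 2 < x ^+ 2.
  by rewrite ltr_pXn2r ?nnegrE // ltW // (le_lt_trans r0).
apply/max_idPl.
rewrite subr_le0 /sect_hi /sect_lo /chord ler0_sqrtr; last by rewrite subr_le0 ltW.
by rewrite ge_min !le_max oppr0 lexx !orbT.
Qed.

Lemma lebesgue_measure_between (a b : R) (A : set R) : measurable A ->
  `]a, b[ `<=` A -> A `<=` `[a, b] -> mu A = (Num.max 0 (b - a))%:E.
Proof.
move=> mA oA Ac; apply/eqP; rewrite eq_le; apply/andP; split.
  apply: (@le_trans _ _ (mu `[a, b])).
    by apply: le_measure => //; rewrite inE //=; exact: measurable_itv.
  rewrite lebesgue_measure_itv /= lte_fin; case: ifPn => ab.
    by rewrite -EFinB lee_fin le_max lexx orbT.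
  by rewrite lee_fin le_max lexx.
apply: (@le_trans _ _ (mu `]a, b[)); last first.
  by apply: le_measure => //; rewrite inE //=; exact: measurable_itv.
rewrite lebesgue_measure_itv /= lte_fin; case: ifPn => ab.
  by rewrite -EFinB lee_fin ge_max lexx subr_ge0 ltW.
by rewrite lee_fin ge_max lexx subr_le0 leNgt.
Qed.

Lemma measure_xsection_sect al e r x : 0 <= r -> 0 < x ->
  mu (xsection (sect al e r) x) = (sect_len al e r x)%:E.
Proof.
move=> r0 x0; have [xr|rx] := leP x r.
  have xr2 : x ^+ 2 <= r ^+ 2 by rewrite ler_pXn2r ?nnegrE // ltW.
  apply: lebesgue_measure_between.
  - have -> : xsection (sect al e r) x =
        `](al - e) * x, (al + e) * x[ `&` `[- chord r x, chord r x].
      apply/seteqP; split => y /=; rewrite /xsection /= !in_itv /=.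
        by move=> /set_mem /(sect_sectionE _ _ _ _ x0)[_]; rewrite ler_norml.
      move=> [? ?]; apply/mem_set/sect_sectionE => //.
      by split => //; rewrite ler_norml.
    by apply: measurableI; exact: measurable_itv.
  - move=> y /=; rewrite in_itv /= /sect_lo /sect_hi gt_max lt_min.
    move=> /andP[/andP[h1 h2] /andP[h3 h4]]; apply/mem_set/sect_sectionE => //.
    by split; rewrite ?h1 ?h3 // ler_norml !ltW.
  - move=> y /=; rewrite /xsection /= => /set_mem /(sect_sectionE _ _ _ _ x0)[_].
    rewrite ler_norml => /andP[h1 h2] /andP[h3 h4].
    by rewrite in_itv /= /sect_lo /sect_hi ge_max le_min h1 h2 !ltW.
have xr2 : r ^+ 2 < x ^+ 2 by rewrite ltr_pXn2r ?nnegrE // ltW.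
have -> : xsection (sect al e r) x = set0.
  apply/seteqP; split => y //= /set_mem /(sect_sectionE _ _ _ _ x0)[+ _ _].
  by rewrite leNgt xr2.
by rewrite measure0 sect_len_out.
Qed.

Lemma continuous_sect_len al e r : continuous (sect_len al e r : R -> R^o).
Proof.
have cC : continuous (chord r : R -> R^o).
  move=> x; apply: (@continuous_comp _ _ _ (fun x : R => r ^+ 2 - x ^+ 2) Num.sqrt).
    by apply: continuousB; [exact: cst_continuous | exact: exprn_continuous].
  exact: sqrt_continuous.
have cM (k : R) : continuous (fun x : R => k * x : R^o).
  by move=> x; apply: mulrl_continuous.
move=> x; apply: (@continuous_max R R (cst 0)
  (fun x => sect_hi al e r x - sect_lo al e r x)); first exact: cst_continuous.
apply: continuousB.
  apply: (@continuous_min R R ( *%R (al + e)) (chord r)); [exact: cM | exact: cC].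
apply: (@continuous_max R R ( *%R (al - e)) (fun x => - chord r x)).
  exact: cM.
by apply: continuousN; exact: cC.
Qed.

Lemma integrable_continuous (f : R -> R) a b : continuous (f : R -> R^o) ->
  mu.-integrable `[a, b] (EFin \o f).
Proof.
move=> cf; apply: continuous_compact_integrable; first exact: segment_compact.
exact: continuous_subspaceT.
Qed.

Lemma sect_area_integral al e r (N : R) : 0 <= r -> r <= N ->
  sect_area al e r = \int[mu]_(x in `[0, N]) sect_len al e r x.
Proof.
move=> r0 rN; rewrite /sect_area /product_measure1 /=.
rewrite -Rintegral_itv_obnd_cbnd; last first.
  apply: integrableS (integrable_continuous 0 N (@continuous_sect_len al e r)) => //.
    exact: subset_itv_oc_cc.
congr fine; rewrite [RHS]integral_mkcond; apply: eq_integral => x _ /=.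
rewrite patchE; case: ifPn => [/set_mem|/negP xN].
  by rewrite /= in_itv /= => /andP[x0 _]; rewrite measure_xsection_sect.
have [x0|x0] := leP x 0.
  rewrite (_ : xsection _ _ = set0) ?measure0 //.
  by apply/seteqP; split => y //= /set_mem [/=]; rewrite ltNge x0.
rewrite (_ : xsection _ _ = set0) ?measure0 //.
apply/seteqP; split => y //= /set_mem /(sect_sectionE _ _ _ _ x0)[+ _ _].
rewrite ler_pXn2r ?nnegrE ?(ltW x0) // => xr; apply: xN; apply/mem_set.
by rewrite /= in_itv /= x0 (le_trans xr).
Qed.

Lemma Rintegral_linear (k Y : R) : 0 <= Y ->
  \int[mu]_(x in `[0, Y]) (2 * k * x) = k * Y ^+ 2.
Proof.
rewrite le_eqVlt => /predU1P[<-|Y0].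
  by rewrite set_itv1 Rintegral_set1 expr0n mulr0.
rewrite /Rintegral (@continuous_FTC2 _ _ (fun x => k * x ^+ 2)) //=.
- by rewrite expr0n /= mulr0 subr0.
- apply: continuous_subspaceT => x; exact: mulrl_continuous.
- split.
  + by move=> x _; exact: ex_derive.
  + apply: cvg_at_right_filter; apply: cvgM; first exact: cvg_cst.
    exact: exprn_continuous.
  + apply: cvg_at_left_filter; apply: cvgM; first exact: cvg_cst.
    exact: exprn_continuous.
- move=> x _; rewrite derive1E derive_val /GRing.scale /=; ring.
Qed.

End Sections.

Section Areas.
Variable R : realType.
Implicit Types (al e r x : R).
Notation mu := (@lebesgue_measure R).

Lemma sect_len_le al e r x : 0 <= e -> 0 <= x -> sect_len al e r x <= 2 * e * x.
Proof.
move=> e0 x0; rewrite ge_max; apply/andP; split; first by rewrite !mulr_ge0.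
rewrite lerBlDr; apply: (@le_trans _ _ ((al + e) * x)).
  by rewrite ge_min lexx.
have : (al - e) * x <= sect_lo al e r x by rewrite le_max lexx.
lra.
Qed.

Lemma Rintegral_subitv (f : R -> R) (y N : R) : continuous (f : R -> R^o) ->
  0 <= y <= N -> \int[mu]_(x in `[0, N]) f x =
    \int[mu]_(x in `[0, y]) f x + \int[mu]_(x in `]y, N]) f x.
Proof.
move=> cf /andP[y0 yN]; rewrite -(@Rintegral_itvB _ f (BLeft 0) (BRight N) y).
- by rewrite addrC subrK.
- exact: integrable_continuous.
- by rewrite bnd_simp.
- by rewrite bnd_simp.
Qed.

(** The column over x has length 2 e x up to the right edge of the inner
    triangle, at most 2 e x up to that of the outer one, and 0 beyond. *)
Lemma sect_area_estimate al e r : 0 <= r -> 0 < e ->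
  let c := 2 * `|al| + 1 in c * e <= 1 ->
  `|sect_area al e r - e * r ^+ 2 / (1 + al ^+ 2)| <= 3 * c * (e * r) ^+ 2.
Proof.
move=> r0 e0 c ce1.
have c1 : 1 <= c by rewrite lerDr mulr_ge0.
have e1 : 0 < e <= 1 by rewrite e0; nra.
set E := 1 + al ^+ 2.
have E1 : 1 <= E by rewrite lerDl sqr_ge0.
pose X := r / Num.sqrt E.
have X0 : 0 <= X by rewrite divr_ge0 // sqrtr_ge0.
have XE : X ^+ 2 = r ^+ 2 / E by rewrite expr_div_n sqr_sqrtr ?(le_trans _ E1).
have Xr : X ^+ 2 <= r ^+ 2.
  by rewrite XE ler_pdivrMr ?(lt_le_trans _ E1) // ler_peMr ?sqr_ge0.
have Xm0 : 0 <= X * (1 - c * e) by rewrite mulr_ge0 // subr_ge0.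
have ce0 : 0 <= c * e by nra.
have Xp0 : 0 <= X * (1 + c * e) by rewrite mulr_ge0 // addr_ge0.
have clen := @continuous_sect_len R al e r.
have clin : continuous ((fun x => 2 * e * x) : R -> R^o).
  by move=> x; exact: mulrl_continuous.
have := @sect_area_integral _ al e r (r + X * (1 + c * e)) r0.
rewrite lerDl => /(_ Xp0) areaE.
have upper : sect_area al e r <= e * (X * (1 + c * e)) ^+ 2.
  rewrite areaE (@Rintegral_subitv _ (X * (1 + c * e))) ?Xp0 ?lerDr //.
  rewrite [X in _ + X](_ : _ = 0) ?addr0.
    rewrite -Rintegral_linear //; apply: le_Rintegral => //.
    - exact: integrable_continuous.
    - exact: integrable_continuous.
    - by move=> x /=; rewrite in_itv /= => /andP[? _]; rewrite sect_len_le // ltW.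
  under eq_Rintegral => x.
    rewrite inE /= in_itv /= => /andP[Xx _].
    have x0 : 0 < x by exact: le_lt_trans Xx.
    have -> : sect_len al e r x = 0.
      apply: EFin_inj; rewrite -measure_xsection_sect //.
      rewrite [X in mu X](_ : _ = set0) ?measure0 //.
      apply/seteqP; split => y //= /set_mem /(sect_sub_triangle r0 e1)[/= /andP[_ +] _].
      by rewrite leNgt Xx.
    over.
  by rewrite Rintegral_cst // mul0r.
have lower : e * (X * (1 - c * e)) ^+ 2 <= sect_area al e r.
  rewrite areaE (@Rintegral_subitv _ (X * (1 - c * e))) //; last first.
    rewrite Xm0 /=; apply: le_trans (_ : X * (1 + c * e) <= _); last by rewrite lerDr.
    by rewrite ler_wpM2l //; lra.
  rewrite -[leLHS]addr0; apply: lerD; last first.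
    by apply: Rintegral_ge0 => x _; rewrite le_max lexx.
  rewrite -Rintegral_linear //; apply: le_Rintegral => //.
  - exact: integrable_continuous.
  - exact: integrable_continuous.
  - move=> x /=; rewrite in_itv /= le_eqVlt => /andP[/predU1P[<- _|x0 xX]].
      by rewrite mulr0 le_max lexx.
    rewrite -lee_fin -measure_xsection_sect //.
    have -> : (2 * e * x)%:E = mu `](al - e) * x, (al + e) * x[.
      rewrite lebesgue_measure_itv /= lte_fin ltr_pM2r // ifT; last lra.
      by rewrite -EFinB; congr EFin; ring.
    apply: le_measure; rewrite ?inE //=.
      rewrite (_ : xsection _ _ = `](al - e) * x, (al + e) * x[%classic) //.
      apply/seteqP; split => y /=; rewrite in_itv /=.
        by move=> /set_mem /(sect_sectionE _ _ _ _ x0)[].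
      move=> yx; apply/mem_set; apply: (triangle_sub_sect r0 e1).
      by split; rewrite /= ?x0 // slope_itvE.
    move=> y /=; rewrite in_itv /= => yx; apply/mem_set.
    apply: (triangle_sub_sect r0 e1).
    by split; rewrite /= ?x0 // slope_itvE.
have -> : e * r ^+ 2 / E = e * X ^+ 2 by rewrite XE mulrA.
have eX0 : 0 <= e * X ^+ 2 by rewrite mulr_ge0 ?sqr_ge0 // ltW.
have h : 3 * c * e * (e * X ^+ 2) <= 3 * c * (e * r) ^+ 2.
  have -> : 3 * c * e * (e * X ^+ 2) = 3 * c * e ^+ 2 * X ^+ 2 by ring.
  have -> : 3 * c * (e * r) ^+ 2 = 3 * c * e ^+ 2 * r ^+ 2 by ring.
  have : 0 <= 3 * c * e ^+ 2 by rewrite mulr_ge0 ?sqr_ge0 //; lra.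
  by move/ler_wpM2l; apply.
have sqE d : e * (X * d) ^+ 2 = e * X ^+ 2 * d ^+ 2 by ring.
move: upper lower; rewrite !sqE ler_norml.
move: eX0 h; move: (e * X ^+ 2) => W W0 h.
have : W * (1 + c * e) ^+ 2 <= W * (1 + 3 * (c * e)) by rewrite ler_wpM2l //; nra.
have : W * (1 - 3 * (c * e)) <= W * (1 - c * e) ^+ 2 by rewrite ler_wpM2l //; nra.
lra.
Qed.

(** * Comparing columns with the integral *)

(** The bound [d] may depend on the unit interval, so for a monotone function the
    right-hand side telescopes to the total variation, however steep it is. *)
Lemma riemann_sum (f : R -> R) (d : nat -> R) n : continuous (f : R -> R^o) ->
  (forall i x, i%:R <= x <= i.+1%:R -> `|f x - f i.+1%:R| <= d i) ->
  `|\int[mu]_(x in `[0, n%:R]) f x - \sum_(i < n) f i.+1%:R| <= \sum_(i < n) d i.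
Proof.
move=> cf fd; elim: n => [|n IH].
  by rewrite !big_ord0 set_itv1 Rintegral_set1 subrr normr0.
rewrite !big_ord_recr /= (@Rintegral_subitv _ n%:R) // ?ler0n ?ler_nat //=.
rewrite opprD addrACA; apply: (le_trans (ler_normD _ _)); apply: lerD => //.
have intf : mu.-integrable `]n%:R, n.+1%:R] (EFin \o f).
  apply: integrableS (integrable_continuous n%:R n.+1%:R cf) => //.
  exact: subset_itv_oc_cc.
have intc k : mu.-integrable `]n%:R, n.+1%:R] (EFin \o cst (k : R)).
  apply: integrableS (integrable_continuous n%:R n.+1%:R (@cst_continuous _ _ k)) => //.
  exact: subset_itv_oc_cc.
have cstE k : \int[mu]_(x in `]n%:R, n.+1%:R]) k = k.
  rewrite Rintegral_cst //= lebesgue_measure_itv /= lte_fin ltr_nat leqnn /=.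
  by rewrite -natr1 addrAC subrr add0r mulr1.
have fdn x : n%:R < x <= n.+1%:R -> f n.+1%:R - d n <= f x <= f n.+1%:R + d n.
  move=> /andP[/ltW nx xn]; have := fd n x; rewrite nx xn => /(_ isT).
  by rewrite ler_norml; lra.
rewrite ler_distl; apply/andP; split.
  rewrite -[leLHS]cstE; apply: le_Rintegral => //=; first exact: intc.
  by move=> x; rewrite in_itv /= => /fdn/andP[].
rewrite -[leRHS]cstE; apply: le_Rintegral => //=; first exact: intc.
by move=> x; rewrite in_itv /= => /fdn/andP[].
Qed.

Lemma ler_dist_max (a b a' b' : R) :
  `|Num.max a b - Num.max a' b'| <= `|a - a'| + `|b - b'|.
Proof.
have := lexx `|a - a'|; rewrite {1}ler_norml; have := lexx `|b - b'|.
rewrite {1}ler_norml ler_norml; move: `|a - a'| `|b - b'| => u v.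
by case: (leP a b) => ?; case: (leP a' b') => ?; lra.
Qed.

Lemma ler_dist_min (a b a' b' : R) :
  `|Num.min a b - Num.min a' b'| <= `|a - a'| + `|b - b'|.
Proof.
have := lexx `|a - a'|; rewrite {1}ler_norml; have := lexx `|b - b'|.
rewrite {1}ler_norml ler_norml; move: `|a - a'| `|b - b'| => u v.
by case: (leP a b) => ?; case: (leP a' b') => ?; lra.
Qed.

Lemma chord_nincr r x y : 0 <= x <= y -> chord r y <= chord r x.
Proof.
move=> /andP[x0 xy]; rewrite ler_wsqrtr // lerD2l lerN2.
by rewrite ler_pXn2r ?nnegrE // (le_trans x0).
Qed.

(** Maximum and minimum change by at most the sum of the changes of their
    arguments, so the two linear bounds contribute |al| + 1 each and the two
    occurrences of the chord contribute its decrease. *)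
Lemma sect_len_variation al e r x y : 0 < e <= 1 -> 0 <= x <= y -> y <= x + 1 ->
  `|sect_len al e r x - sect_len al e r y| <=
  2 * (`|al| + 1) + 2 * (chord r x - chord r y).
Proof.
move=> /andP[e0 e1] xy yx1; have := chord_nincr r xy; case/andP: xy => x0 xy cxy.
have lin b : `|b| <= `|al| + 1 -> `|b * x - b * y| <= `|al| + 1.
  move=> bal; rewrite -mulrBr normrM (distrC x) (ger0_norm (x := y - x)) ?subr_ge0 //.
  have := normr_ge0 b; nra.
have a1 : `|al + e| <= `|al| + 1.
  by apply: (le_trans (ler_normD _ _)); rewrite lerD2l (ger0_norm (ltW e0)).
have a2 : `|al - e| <= `|al| + 1.
  by apply: (le_trans (ler_normB _ _)); rewrite lerD2l (ger0_norm (ltW e0)).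
have hc : `|chord r x - chord r y| = chord r x - chord r y.
  by rewrite ger0_norm // subr_ge0.
apply: (le_trans (ler_dist_max _ _ _ _)); rewrite subrr normr0 add0r.
rewrite opprB [X in `|X|](_ : _ = (sect_hi al e r x - sect_hi al e r y)
   + (sect_lo al e r y - sect_lo al e r x)); last ring.
apply: (le_trans (ler_normD _ _)).
have := ler_dist_min ((al + e) * x) (chord r x) ((al + e) * y) (chord r y).
have := ler_dist_max ((al - e) * y) (- chord r y) ((al - e) * x) (- chord r x).
rewrite opprK (addrC (- chord r y)) -/(sect_lo _ _ _ _) -/(sect_lo _ _ _ _).
rewrite -/(sect_hi _ _ _ _) -/(sect_hi _ _ _ _).
have := lin _ a1; have := lin _ a2.
rewrite (distrC (_ * x)) hc; lra.
Qed.

(** Shortening the column by 1 at the top, or lengthening it by 1 at the bottom,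
    gives half-open intervals that lie in its interior or contain it with both
    end points; each has the right number of integers up to 2. *)
Lemma sect_count_columns al e r : 0 <= r ->
  `|(sect_count al e r)%:R - \sum_(i < Num.truncn r) sect_len al e r i.+1%:R|
  <= 2 * r.
Proof.
move=> r0; set M := Num.truncn r.
pose ks := [seq i.+1%:Z | i <- iota 0 M].
have uks : uniq ks by rewrite map_inj_uniq ?iota_uniq // => i j; lia.
have pinj : injective (fun kj : int * int => (kj.1, kj.2)) by move=> [? ?] [? ?].
have bound (js : int -> seq int) :
    (forall i, `|(size (js i.+1%:Z))%:R - sect_len al e r i.+1%:R| <= 2) ->
    `|(size (dep_pairs pair ks js))%:R - \sum_(i < M) sect_len al e r i.+1%:R| <= 2 * r.
  move=> jsP; rewrite size_dep_pairs natr_sum big_map.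
  have -> : iota 0 M = index_iota 0 M by rewrite /index_iota subn0.
  rewrite big_mkord -sumrB.
  apply: (le_trans (ler_norm_sum _ _ _)).
  apply: (@le_trans _ _ (\sum_(i < M) 2)); first by apply: ler_sum => i _; exact: jsP.
  by rewrite sumr_const card_ord -[2 *+ M]mulr_natr ler_wpM2l // truncn_le.
pose jlow (m : int) := int_itv (sect_lo al e r m%:~R) (sect_hi al e r m%:~R - 1).
pose jupp (m : int) := int_itv (sect_lo al e r m%:~R - 1) (sect_hi al e r m%:~R).
rewrite ler_norml; apply/andP; split.
  have /bound : forall i, `|(size (jlow i.+1%:Z))%:R - sect_len al e r i.+1%:R| <= 2.
    move=> i; rewrite /jlow /sect_len ler_norml.
    set lo := sect_lo _ _ _ _; set hi := sect_hi _ _ _ _.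
    have := size_int_itv_ge lo (hi - 1); have := size_int_itv_le lo (hi - 1).
    have : 0 <= (size (int_itv lo (hi - 1)))%:R :> R by exact: ler0n.
    by rewrite /Num.max; case: ifP => ?; case: ifP => ?; lra.
  rewrite ler_norml => /andP[+ _] => /le_trans; apply.
  rewrite lerD2r ler_nat; apply: card_fset_set_ge_size.
  - exact: finite_sect_lattice.
  - by apply: uniq_dep_pairs => // k; exact: uniq_int_itv.
  - move=> z /allpairsPdep[m [n [/mapP[i + ->] + ->]]].
    rewrite mem_iota add0n /= mem_int_itv /sect_lo /sect_hi => iM.
    rewrite gt_max lerBrDr le_min => /andP[/andP[h1 h2] /andP[h3 h4]].
    have i0 : 0 < i.+1%:R :> R by rewrite ltr0n.
    have ir : i.+1%:R <= r by rewrite -truncn_ge_nat.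
    apply/sect_sectionE => //=; split.
    + by rewrite ler_pXn2r ?nnegrE.
    + by rewrite ler_norml (ltW h2); lra.
    + by rewrite h1; lra.
have /bound : forall i, `|(size (jupp i.+1%:Z))%:R - sect_len al e r i.+1%:R| <= 2.
  move=> i; rewrite /jupp /sect_len ler_norml.
  set lo := sect_lo _ _ _ _; set hi := sect_hi _ _ _ _.
  have := size_int_itv_ge (lo - 1) hi; have := size_int_itv_le (lo - 1) hi.
  have : 0 <= (size (int_itv (lo - 1) hi))%:R :> R by exact: ler0n.
  by rewrite /Num.max; case: ifP => ?; case: ifP => ?; lra.
rewrite ler_norml => /andP[_]; apply: le_trans.
rewrite lerD2r ler_nat; apply: card_fset_set_le_size => -[m n] mn.
have m0 : 0 < m by case: mn => /=; rewrite ltr0z.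
have mR : 0 < m%:~R :> R by rewrite ltr0z.
move/(sect_sectionE _ _ _ _ mR): mn; rewrite ler_norml.
move=> [mr /andP[h1 h2] /andP[h3 h4]]; apply: mem_dep_pairs.
  apply/mapP; exists (absz m).-1; last by lia.
  rewrite mem_iota /= add0n ltnNge; apply/negP.
  have : (absz m)%:R <= r.
    rewrite natr_absz gtr0_norm // -(ler_pXn2r (n := 2)) // nnegrE //.
    exact: ltW.
  by rewrite -truncn_ge_nat // -/M; lia.
rewrite mem_int_itv /sect_lo /sect_hi le_min h2 (ltW h4) !andbT.
by rewrite ltrBlDr; apply: le_lt_trans (_ : n%:~R < _); rewrite ?ltrDl // ge_max h1 ltW.
Qed.

(** The column over the first integer beyond r is empty, so adding it to the sum
    lets the integral run over a whole number of unit intervals.  Since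
    sqrt(r^2 - x^2) is monotone, its oscillations telescope to at most r. *)
Lemma sect_count_area al e r : 1 <= r -> 0 < e <= 1 ->
  `|(sect_count al e r)%:R - sect_area al e r| <= (4 * `|al| + 8) * r.
Proof.
move=> r1 e01; have r0 : 0 <= r by exact: le_trans r1.
set M := Num.truncn r; have Mr : M%:R <= r by rewrite truncn_le.
have rM : r < M.+1%:R by rewrite truncnS_gt.
have := sect_count_columns al e r0; rewrite -/M.
have -> : \sum_(i < M) sect_len al e r i.+1%:R =
          \sum_(i < M.+1) sect_len al e r i.+1%:R.
  by rewrite big_ord_recr /= sect_len_out // addr0.
have := @riemann_sum (sect_len al e r)
  (fun i => 2 * (`|al| + 1) + 2 * (chord r i%:R - chord r i.+1%:R)) M.+1
  (@continuous_sect_len _ al e r).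
rewrite -sect_area_integral //; last exact: ltW.
have -> : \sum_(i < M.+1) (2 * (`|al| + 1) + 2 * (chord r i%:R - chord r i.+1%:R))
   = 2 * (`|al| + 1) * M.+1%:R + 2 * (r - chord r M.+1%:R).
  rewrite big_split /= sumr_const card_ord -[_ *+ _]mulr_natr; congr (_ + _).
  rewrite -mulr_sumr -(big_mkord xpredT (fun i => chord r i%:R - chord r i.+1%:R)).
  rewrite (telescope_sumr_eq (fun i => - chord r i%:R)) //; last first.
    by move=> i _; rewrite opprK addrC.
  rewrite opprK addrC /chord expr0n subr0 sqrtr_sqr ger0_norm //.
rewrite !ler_norml => hI hC.
have /hI : forall i x, i%:R <= x <= i.+1%:R ->
    `|sect_len al e r x - sect_len al e r i.+1%:R| <=
    2 * (`|al| + 1) + 2 * (chord r i%:R - chord r i.+1%:R).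
  move=> i x /andP[ix xi]; have i0 : 0 <= i%:R :> R by rewrite ler0n.
  apply: (le_trans (@sect_len_variation al e r x i.+1%:R e01 _ _)).
  - by rewrite (le_trans i0 ix).
  - by rewrite -natr1 lerD2r.
  - by have := @chord_nincr r i%:R x; rewrite i0 ix => /(_ isT); lra.
have : chord r M.+1%:R >= 0 by rewrite sqrtr_ge0.
have : `|al| * M.+1%:R <= `|al| * (2 * r).
  by rewrite ler_wpM2l // -natr1; lra.
move: hC; rewrite -natr1; lra.
Qed.

(** The integer q n - p m has absolute value below q e r <= 1, so it vanishes and
    (m,n) is a multiple of (q,p). *)
Lemma sect_count_ray (p q : int) e r : 0 < q -> coprimez p q -> 0 < e -> 0 <= r ->
  q%:~R * e * r <= 1 ->
  `|(sect_count (p%:~R / q%:~R) e r)%:R - r / Num.sqrt (p%:~R ^+ 2 + q%:~R ^+ 2)|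
  <= 1.
Proof.
move=> q0 /coprimezP[[w u] uv] e0 r0 qer; rewrite /= in uv.
have q0R : 0 < q%:~R :> R by rewrite ltr0z.
set D := p%:~R ^+ 2 + q%:~R ^+ 2; set D' := Num.sqrt D.
have D0 : 0 < D by rewrite ltr_wpDl ?sqr_ge0 // exprn_gt0.
have D'0 : 0 < D' by rewrite sqrtr_gt0.
pose s := [seq (j * q, j * p) | j <- int_itv 0 (r / D')].
have us : uniq s.
  rewrite map_inj_uniq ?uniq_int_itv // => i j [+ _].
  by apply: mulIf; rewrite gt_eqF.
have sP z : sect_lattice (p%:~R / q%:~R) e r z <-> z \in s.
  have radius (j : int) : 0 < j%:~R :> R -> ((j * q)%:~R ^+ 2 + (j * p)%:~R ^+ 2 <= r ^+ 2)
      = (j%:~R <= r / D').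
    move=> j0; rewrite ler_pdivlMr //.
    have -> : (j%:~R * D' <= r) = ((j%:~R * D') ^+ 2 <= r ^+ 2).
      by rewrite ler_pXn2r ?nnegrE // mulr_ge0 // ltW.
    by rewrite exprMn sqr_sqrtr ?(ltW D0) // !rmorphM /= !exprMn -mulrDr addrC.
  case: z => m n; split.
    move=> [/= mR mnr]; have m0 : 0 < m by rewrite -(ltr0z R).
    rewrite slope_itv_rat // => knq.
    have k0 : q * n = p * m.
      apply/eqP; rewrite -subr_eq0 -absz_eq0 -leqn0 -ltnS -(ltr_nat R).
      apply: (lt_le_trans knq); apply: le_trans qer; rewrite ler_wpM2l //.
        by rewrite mulr_ge0 // ltW.
      rewrite -(ler_pXn2r (n := 2)) ?nnegrE ?(ltW mR) //.
      by apply: le_trans mnr; rewrite lerDl sqr_ge0.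
    pose j := w * n + u * m.
    have mE : m = j * q by rewrite -[LHS]mulr1 -uv mulrDr mulrCA (mulrC m p) -k0 /j; ring.
    have nE : n = j * p.
      by apply: (mulfI (lt0r_neq0 q0)); rewrite k0 {1}mE; ring.
    have j0 : 0 < j%:~R :> R by rewrite ltr0z; nia.
    rewrite mE nE in mnr *; apply/mapP; exists j => //.
    by rewrite mem_int_itv j0 -radius.
  move=> /mapP[j + [-> ->]]; rewrite mem_int_itv => /andP[j0 jr].
  have jq0 : 0 < (j * q)%:~R :> R by rewrite rmorphM mulr_gt0.
  split; rewrite //= ?radius //.
  rewrite slope_itv_rat -?(ltr0z R) //.
  have -> : q * (j * p) - p * (j * q) = 0 by ring.
  by rewrite !mulr_gt0.
have -> : sect_count (p%:~R / q%:~R) e r = size s.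
  apply/eqP; rewrite eqn_leq; apply/andP; split.
    by apply: card_fset_set_le_size => z /sP.
  apply: card_fset_set_ge_size => //; first exact: finite_sect_lattice.
  by move=> z /sP.
have rD : 0 <= r / D' by rewrite divr_ge0 // ltW.
have := size_int_itv_ge 0 (r / D'); have := size_int_itv_le 0 (r / D').
have -> : Num.max 0 (r / D' - 0 + 1) = r / D' + 1.
  by rewrite subr0; apply/max_idPr; rewrite addr_ge0.
have -> : size s = size (int_itv 0 (r / D')) by rewrite [LHS]size_map.
by rewrite subr0 ler_norml; lra.
Qed.

End Areas.

(** * Asymptotics in the radius *)

Lemma bigO_of_le (R : realType) (f g h : R -> R) (C r0 : R) :
  (forall r, r0 <= r -> `|f r - g r| <= C * `|h r|) -> f = g +O_+oo h.
Proof.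
move=> fgh; apply/eqaddOP; near=> k; near=> r.
apply: (@le_trans _ _ (C * `|h r|)).
  by apply: fgh; near: r; apply: nbhs_pinfty_ge; exact: num_real.
by apply: ler_wpM2r => //; near: k; apply: nbhs_pinfty_ge; exact: num_real.
Unshelve. all: by end_near. Qed.

(** This turns smallness of R^(-lambda) into an explicit threshold for R. *)
Lemma powRN_le (R : realType) (l C r : R) : 0 < l -> 0 <= C -> C `^ l^-1 <= r ->
  C * r `^ (- l) <= 1.
Proof.
move=> l0 C0 Cr; have [->|Cn0] := eqVneq C 0; first by rewrite mul0r.
have r0 : 0 < r by apply: (lt_le_trans _ Cr); apply: powR_gt0; rewrite lt0r Cn0.
rewrite powRN ler_pdivrMr ?powR_gt0 // mul1r.
have -> : C = (C `^ l^-1) `^ l by rewrite -powRrM mulVf ?powRr1 ?gt_eqF.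
by apply: ge0_ler_powR; rewrite ?nnegrE ?powR_ge0 // ltW.
Qed.

Lemma powRN_itv (R : realType) (l r : R) : 0 <= l -> 1 <= r ->
  0 < r `^ (- l) <= 1.
Proof.
move=> l0 r1; rewrite powR_gt0 ?(lt_le_trans _ r1) //=.
by rewrite -(powRr0 r) ler_powR // oppr_le0.
Qed.

Lemma powRN_mul (R : realType) (l r : R) : 0 < r ->
  r `^ (- l) * r = r `^ (1 - l).
Proof.
move=> r0; rewrite -{2}(powRr1 (ltW r0)) -powRD 1?addrC //.
by rewrite (lt0r_neq0 r0) implybT.
Qed.

Lemma beta_sawtooth (R : realType) (p q : int) (l r : R) :
  beta p q (r `^ (- l)) r * r `^ l =
  sawtooth (r `^ (- l) * q%:~R ^+ 2 * r / Num.sqrt (p%:~R ^+ 2 + q%:~R ^+ 2))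
    / (q%:~R ^+ 2 * r `^ (- l)).
Proof.
rewrite /beta /sawtooth; set t := Defs.frac _.
by rewrite powRN [(_ * _^-1)^-1]invfM invrK; ring.
Qed.

(** Since e^(-1) = r^l and e r = r^(1-l), this is the difference of the estimates
    for the count and for the area, both with main term e r^2/(1 + al^2). *)
Lemma sect_count_beta (R : realType) (p q : int) (l : R) :
  0 < q -> coprimez p q -> 0 < l <= 1 ->
  let al : R := p%:~R / q%:~R in
  exists C r0 : R, [/\ 0 <= C, 1 <= r0 & forall r, r0 <= r ->
   `|(sect_count al (r `^ (- l)) r)%:R - (sect_area al (r `^ (- l)) r
       + beta p q (r `^ (- l)) r * r `^ l)| <= C * r `^ (2 - 2 * l)].
Proof.
move=> q0 pq /andP[l0 l1] al.
set c := 2 * `|al| + 1; have c0 : 0 <= c by rewrite addr_ge0 // mulr_ge0.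
have q0R : 0 < q%:~R :> R by rewrite ltr0z.
exists (7 * c + 4 * q%:~R + 1), (Num.max 1 (c `^ l^-1)); split.
- by rewrite !addr_ge0 // mulr_ge0 // ltW.
- by rewrite le_max lexx.
move=> r; rewrite ge_max => /andP[r1 cr].
have r0 : 0 < r by exact: lt_le_trans r1.
have /andP[e0 e1] := powRN_itv (ltW l0) r1.
have ce1 := powRN_le l0 c0 cr.
have er1 : 1 <= r `^ (- l) * r.
  by rewrite powRN_mul // -[leLHS](powRr0 r) ler_powR // subr_ge0.
rewrite beta_sawtooth.
have -> : r `^ (2 - 2 * l) = (r `^ (- l) * r) ^+ 2.
  rewrite powRN_mul // -powR_mulrn ?powR_ge0 // -powRrM.
  by congr (_ `^ _); ring.
have := sect_count_estimate q0 pq e0 ce1 er1.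
have := sect_area_estimate (al := al) (ltW r0) e0 ce1.
rewrite -/al -/c; rewrite !ler_norml; lra.
Qed.
Theorem corollary1p6 (R : realType) (p q : int) (lambda : R) :
  0 < q -> coprimez p q ->
  let alpha : R := p%:~R / q%:~R in
  let eps (r : R) : R := r `^ (- lambda) in
  let S_alpha (r : R) : R := (sect_count alpha (eps r) r)%:R in
  let area (r : R) : R := sect_area alpha (eps r) r in
  [/\ 0 <= lambda <= 1 / 2 ->
        S_alpha = area +O_+oo (fun r : R => r),
      1 / 2 < lambda <= 2 / 3 ->
        S_alpha = area +O_+oo (fun r : R => r `^ (2 - 2 * lambda)),
      2 / 3 < lambda < 1 ->
        S_alpha = (fun r => area r + beta p q (eps r) r * r `^ lambda)
          +O_+oo (fun r : R => r `^ (2 - 2 * lambda)) &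
      1 < lambda ->
        S_alpha = (fun r => r / Num.sqrt (p%:~R ^+ 2 + q%:~R ^+ 2))
          +O_+oo (fun=> 1 : R)].

Proof.
move=> q0 pq alpha eps S_alpha area; split.
- move=> /andP[l0 l12]; apply: (@bigO_of_le _ _ _ _ (4 * `|alpha| + 8) 1) => r r1.
  rewrite (ger0_norm (x := r)); last exact: le_trans r1.
  by apply: sect_count_area => //; exact: powRN_itv.
- move=> /andP[l12 l23].
  have l01 : 0 < lambda <= 1 by apply/andP; split; lra.
  have [C [r0 [C0 r01 CP]]] := sect_count_beta q0 pq l01.
  (* the extra 1 absorbs beta R^lambda, as lambda <= 2 - 2 lambda *)
  apply: (@bigO_of_le _ _ _ _ (C + 1) r0) => r rr0.
  have r1 : 1 <= r by exact: le_trans rr0.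
  have := CP r rr0; rewrite (ger0_norm (powR_ge0 _ _)) beta_sawtooth.
  set s := sawtooth _ / _ => CPr.
  have s0 : 0 <= s.
    by rewrite divr_ge0 ?sawtooth_ge0 // mulr_ge0 ?sqr_ge0 ?powR_ge0.
  have s1 : s <= r `^ (2 - 2 * lambda).
    apply: (@le_trans _ _ (r `^ lambda)); last by apply: ler_powR => //; lra.
    rewrite /s powRN invfM invrK mulrA; apply: ler_piMl; first exact: powR_ge0.
    have q1 : 1 <= q%:~R ^+ 2 :> R.
      by rewrite exprn_ege1 // ler1z -gtz0_ge1.
    rewrite ler_pdivrMr ?(lt_le_trans _ q1) // mul1r.
    exact: le_trans (sawtooth_le1 _) q1.
  move: CPr s0 s1; rewrite /S_alpha /area /eps !ler_norml.
  rewrite -/alpha; lra.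
- move=> /andP[l23 l1].
  have l01 : 0 < lambda <= 1 by apply/andP; split; lra.
  have [C [r0 [C0 r01 CP]]] := sect_count_beta q0 pq l01.
  apply: (@bigO_of_le _ _ _ _ C r0) => r rr0.
  by rewrite (ger0_norm (powR_ge0 _ _)); exact: CP.
- move=> l1; have q0R : 0 < q%:~R :> R by rewrite ltr0z.
  have l10 : 0 < lambda - 1 by rewrite subr_gt0.
  apply: (@bigO_of_le _ _ _ _ 1 (Num.max 1 (q%:~R `^ (lambda - 1)^-1))) => r.
  rewrite ge_max normr1 mulr1 => /andP[r1 qr].
  have r0 : 0 < r by exact: lt_le_trans r1.
  apply: sect_count_ray => //; [exact: powR_gt0|exact: ltW|].
  rewrite -mulrA powRN_mul // -opprB; apply: powRN_le => //; exact: ltW.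
Qed.
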